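(* Let $X$ be a real Hilbert space, let $M_1,\dots,M_k$ be finitely many closed linear subspaces of $X$, let $M:=\bigcap_{l=1}^k M_l$, and let $x_0\in M_1$. Let $\{x_i\}_{i\ge 0}$, $\{x_i'\}_{i\ge 0}$, $\{x_i''\}_{i\ge 0}$ (with associated indices $l_i$, vectors $a_i$, index sets $J_i$ and subspaces $\tilde H_i$) be infinite sequences generated from $x_0$ by the Accelerated Projections 2 algorithm. Suppose that: (A) There is a number $\bar p$ such that for all $l\in\{2,\dots,k\}$ and all $i>0$ there is an integer $p_i^l\in[0,\bar p]$ such that $x'_{i+p_i^l}=P_{M_l}(x_{i+p_i^l})$. (B) The $\tilde H_i$ are chosen such that $x_0-x_i\in\mathrm{span}(\{a_j:j\in J_i\})$ for all iterations $i$. Then the sequence $\{x_i\}_i$ converges strongly (i.e. in norm) to $P_M(x_0)$.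
   Context: For a closed linear (or affine) subspace $N$ of $X$, $P_N$ denotes the orthogonal projection onto $N$. Accelerated Projections 2 algorithm: given closed linear subspaces $M_1,\dots,M_k$ of $X$ and a starting point $x_0\in M_1$, for $i=0,1,2,\dots$ (run indefinitely): Step 1: choose $l_i\in\{2,\dots,k\}$, set $x_i':=P_{M_{l_i}}(x_i)$ and $x_i'':=P_{M_1}(x_i')$. Put $a_i:=x_i-x_i''$, $b_i:=\left\langle a_i,\,x_i+\frac{\|x_i-x_i'\|^2}{\|x_i-x_i''\|^2}(x_i''-x_i)\right\rangle\in\mathbb{R}$, and $H_i:=\{x\in X:\langle a_i,x\rangle=b_i\}$ (so $M_1\cap M_{l_i}\subset H_i$); when $a_i=0$, $H_i:=X$. Step 2: choose $J_i\subset\{0,1,\dots,i\}$ with $i\in J_i$, put $\tilde H_i:=\bigcap_{j\in J_i}H_j$, and set $x_{i+1}:=P_{\tilde H_i}(x_i)$ (which also equals $P_{\tilde H_i}(x_i'')$). *)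

(* Defs.v *)
From mathcomp Require Import all_boot all_order all_algebra.
From mathcomp Require Import sesquilinear.
From mathcomp Require Import all_classical all_reals all_analysis.

Set Implicit Arguments.
Unset Strict Implicit.
Unset Printing Implicit Defensive.

Import Order.TTheory GRing.Theory Num.Theory.
Import numFieldNormedType.Exports.

Local Open Scope classical_set_scope.
Local Open Scope ring_scope.

(* A real Hilbert space is a complete normed module X over R : realType
   together with a positive definite symmetric bilinear form dot on X whose
   associated norm is the norm of X. *)
Definition norm_from_dot (R : realType) (X : completeNormedModType R)
    (dot : {dot X for idfun}) : Prop :=
  forall x : X, dot x x = `|x| ^+ 2.

Definition closed_subspace (R : realType) (X : normedModType R)
    (N : set X) : Prop :=
  submod_closed [in N] /\ closed N.

Definition linear_span (R : realType) (X : lmodType R) (A : set X) : set X :=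
  [set v | exists n (c : 'I_n -> R) (u : 'I_n -> X),
     (forall i, A (u i)) /\ v = \sum_(i < n) c i *: u i].

(* The direction space of the affine subspace N is {y - p | y in N} for any
   p in N, so this covers both linear and affine subspaces. *)
Definition is_orthogonal_projection (R : realType)
    (X : completeNormedModType R) (dot : {dot X for idfun})
    (N : set X) (x p : X) : Prop :=
  N p /\ forall y, N y -> dot (x - p) (y - p) = 0.

(* Such a p is unique, and exists if N is a nonempty closed affine subspace;
   otherwise the value is arbitrary. *)
Definition orthproj (R : realType) (X : completeNormedModType R)
    (dot : {dot X for idfun}) (N : set X) (x : X) : X :=
  get [set p | is_orthogonal_projection dot N x p].

Definition hyperplane (R : realType) (X : completeNormedModType R)
    (dot : {dot X for idfun}) (x x' x'' : X) : set X :=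
  let a := x - x'' in
  let b := dot a (x + (`|x - x'| ^+ 2 / `|x - x''| ^+ 2) *: (x'' - x)) in
  if a == 0 then setT else [set y | dot a y = b].

Definition hyperplane_bigcap (R : realType) (X : completeNormedModType R)
    (dot : {dot X for idfun}) (x x' x'' : nat -> X) (J : set nat) : set X :=
  \bigcap_(j in J) hyperplane dot (x j) (x' j) (x'' j).

(* The subspaces are M 1, ..., M k; the values of M outside {1, ..., k} are
   irrelevant. *)
Definition accelerated_projections2 (R : realType)
    (X : completeNormedModType R) (dot : {dot X for idfun})
    (k : nat) (M : nat -> set X) (x0 : X)
    (x x' x'' a : nat -> X) (l : nat -> nat) (J : nat -> set nat)
    (Ht : nat -> set X) : Prop :=
  x 0%N = x0 /\
  forall i : nat,
    (2 <= l i <= k)%N /\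
    x' i = orthproj dot (M (l i)) (x i) /\
    x'' i = orthproj dot (M 1%N) (x' i) /\
    a i = x i - x'' i /\
    J i `<=` `I_i.+1 /\
    J i i /\
    Ht i = hyperplane_bigcap dot x x' x'' (J i) /\
    x i.+1 = orthproj dot (Ht i) (x i).

(* Main.v *)
Require Import Defs.
From mathcomp Require Import all_boot all_order all_algebra.
From mathcomp Require Import sesquilinear.
From mathcomp Require Import all_classical all_reals all_analysis.
From mathcomp Require Import ring lra.

Set Implicit Arguments.
Unset Strict Implicit.
Unset Printing Implicit Defensive.

Import Order.TTheory GRing.Theory Num.Theory.
Import numFieldNormedType.Exports.

Local Open Scope classical_set_scope.
Local Open Scope ring_scope.

(** For a point [x] of [M_1], the normal [a = x - x''] of the hyperplane
    built at [x] lies in [M_1], is orthogonal to [M_1 `&` M_l], and satisfies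
    [<a, x> = |x - x'|^2].  Hence the hyperplane is the linear hyperplane
    orthogonal to [a] ([hyperplaneE]), and its distance to [x] is at least
    [|x - x'|] because [|a| <= |x - x'|] ([hyperplane_dist]).  All iterates
    stay in [M_1] ([iterate_in_M1]), so each [Ht_i] is a closed linear subspace
    containing [M].

    Consequently [|x_{i+1}|^2 + |x_i - x_{i+1}|^2 = |x_i|^2], the steps tend to
    zero ([step_cvg0]), and so do the residuals [|x_i - x'_i|], which the steps
    dominate ([residual_le_step]).  As every [M_m] is visited in each window of
    bounded length, the distance from [x_i] to each [M_m] tends to zero.

    Condition (B) turns [x_{i+1}], the projection of [x_i] onto [Ht_i], into
    the projection of [x_0] onto [Ht_i]; thus [x_0 - x_i] is orthogonal to [x_i]
    and to [M].  Writing [z] for the projection of [x_0] onto [M], this gives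
    [|x_i - z|^2 = <x_0 - z, x_i - z>]: weak convergence of [x_i] to [z] is
    already strong convergence.

    Weak convergence is a density argument.  The vectors [w] with
    [<w, x_i - z> --> 0] form a closed subspace, as the sequence is bounded.  It
    contains the orthogonal complement of each [M_m], since [x_i] approaches
    [M_m] and [z] lies in it, and it contains [M], since both [x_0 - x_i] and
    [x_0 - z] are orthogonal to [M].  A closed subspace containing all of these
    is the whole space ([weak_null_of_complements]). *)

(** * Real sequences *)

Section RealSequences.
Variable R : realType.

Lemma cvg0_dominated (f g : nat -> R) :
  (\forall n \near \oo, `|f n| <= g n) -> g @ \oo --> 0 -> f @ \oo --> 0.
Proof.
move=> fg g0; apply/norm_cvg0P; apply: (squeeze_cvgr (f := fun=> 0) (h := g)) => //.
- by apply: filterS fg => n ->; rewrite normr_ge0.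
- exact: cvg_cst.
Qed.

Lemma window_sum_cvg0 (d : nat -> R) (q : nat) : d @ \oo --> 0 ->
  (\sum_(j < q) d (n + j)%N) @[n --> \oo] --> 0.
Proof.
move=> d0; elim: q => [|q IH].
  by under eq_fun do rewrite big_ord0; exact: cvg_cst.
under eq_fun do rewrite big_ord_recr /=.
suff: \sum_(j < q) d (n + j)%N + d (n + q)%N @[n --> \oo] --> 0 + 0.
  by rewrite addr0.
apply: cvgD => //.
by have := d0; rewrite -(cvg_shiftn q); exact.
Qed.

End RealSequences.

(** * Linear subspaces *)

Section Subspaces.
Variables (R : pzRingType) (V : lmodType R).
Implicit Types (u v : V) (N : set V).

Lemma subspace0 N : submod_closed [in N] -> N 0.
Proof. by case=> /set_mem. Qed.

Lemma subspaceD N u v : submod_closed [in N] -> N u -> N v -> N (u + v).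
Proof.
case=> _ cN /mem_set Nu /mem_set Nv.
by have /set_mem := cN 1 u v Nu Nv; rewrite scale1r.
Qed.

Lemma subspaceZ N c u : submod_closed [in N] -> N u -> N (c *: u).
Proof.
case=> /mem_set N0 cN /mem_set Nu.
by have /set_mem := cN c u 0 Nu (set_mem N0); rewrite addr0.
Qed.

Lemma subspaceB N u v : submod_closed [in N] -> N u -> N v -> N (u - v).
Proof.
by move=> sN Nu Nv; rewrite -scaleN1r; apply: subspaceD => //; apply: subspaceZ.
Qed.

End Subspaces.

Lemma closed_subspace_bigcap (R : realType) (X : normedModType R) (T : Type)
    (D : set T) (F : T -> set X) :
  (forall t, D t -> closed_subspace (F t)) ->
  closed_subspace (\bigcap_(t in D) F t).
Proof.
move=> cF; split; first split.
- by apply/mem_set => t /cF[sF _]; exact: subspace0.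
- move=> c v w /set_mem Fv /set_mem Fw; apply/mem_set => t Dt.
  have [sF _] := cF t Dt.
  apply: subspaceD => //; first by apply: subspaceZ => //; exact: Fv.
  exact: Fw.
- by apply: closed_bigI => t /cF[].
Qed.

Lemma dist_le_steps (R : realType) (X : normedModType R) (u : nat -> X) (n p : nat) :
  `|u n - u (n + p)%N| <= \sum_(j < p) `|u (n + j)%N - u (n + j).+1|.
Proof.
elim: p => [|p IH]; first by rewrite addn0 subrr normr0 big_ord0.
rewrite big_ord_recr /= addnS (le_trans (ler_distD (u (n + p)%N) _ _))//.
by rewrite lerD2r.
Qed.

(** * Inner products and orthogonal projections *)

Section InnerProduct.
Variables (R : realType) (X : completeNormedModType R).
Variables (dot : {dot X for idfun}) (dot_norm : norm_from_dot dot).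
Implicit Types (u v w x y z p : X) (N C : set X).

Lemma dotC u v : dot u v = dot v u.
Proof. by rewrite hermitian_subproof expr0 mul1r. Qed.

Lemma dotDr u v w : dot u (v + w) = dot u v + dot u w.
Proof. exact: linearD. Qed.
Lemma dotBr u v w : dot u (v - w) = dot u v - dot u w.
Proof. exact: linearB. Qed.
Lemma dotZr c u v : dot u (c *: v) = c * dot u v.
Proof. exact: linearZ. Qed.
Lemma dot0r u : dot u 0 = 0.
Proof. exact: linear0. Qed.
Lemma dotDl u v w : dot (u + v) w = dot u w + dot v w.
Proof. by rewrite dotC dotDr !(dotC w). Qed.
Lemma dotBl u v w : dot (u - v) w = dot u w - dot v w.
Proof. by rewrite dotC dotBr !(dotC w). Qed.
Lemma dotZl c u v : dot (c *: u) v = c * dot u v.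
Proof. by rewrite dotC dotZr dotC. Qed.
Lemma dot0l u : dot 0 u = 0.
Proof. by rewrite dotC dot0r. Qed.
Lemma dotNr u v : dot u (- v) = - dot u v.
Proof. exact: linearN. Qed.
Lemma dotNl u v : dot (- u) v = - dot u v.
Proof. by rewrite dotC dotNr dotC. Qed.
Definition dotE := (dotDl, dotDr, dotNl, dotNr, dotZl, dotZr).

Lemma dot_eq0 u : dot u u = 0 -> u = 0.
Proof. by move=> /eqP; rewrite dot_norm sqrf_eq0 normr_eq0 => /eqP. Qed.

Lemma norm_dotB u v : `|u - v| ^+ 2 = `|u| ^+ 2 - 2 * dot u v + `|v| ^+ 2.
Proof. by rewrite -!dot_norm !dotE (dotC v u); ring. Qed.

Lemma cauchy_schwarz u v : `|dot u v| <= `|u| * `|v|.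
Proof.
rewrite -(@ler_pXn2r _ 2) ?nnegrE ?mulr_ge0// exprMn real_normK ?num_real//.
have [->|v0] := eqVneq v 0; first by rewrite dot0r expr0n mulr_ge0// exprn_ge0.
have v2 : 0 < `|v| ^+ 2 by rewrite exprn_gt0 ?normr_gt0.
(* |v|^2 u - <u, v> v is |v|^2 times the component of u orthogonal to v. *)
have := sqr_ge0 `| `|v| ^+ 2 *: u - dot u v *: v|.
rewrite -(dot_norm (_ - _)) !dotE (dotC v u) !dot_norm => h.
have {}h : 0 <= `|v| ^+ 2 * (`|u| ^+ 2 * `|v| ^+ 2 - dot u v ^+ 2).
  by apply: le_trans h _; rewrite le_eqVlt; apply/orP; left; apply/eqP; ring.
by rewrite -subr_ge0; rewrite pmulr_rge0 in h.
Qed.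

Lemma dot_continuous u : continuous (dot u).
Proof.
apply: bounded_linear_continuous; apply/linear_boundedP.
near=> r => v; apply: le_trans (cauchy_schwarz u v) _.
apply: ler_wpM2r => //; near: r; exact: nbhs_pinfty_ge.
Unshelve. all: by end_near. Qed.

(** The parallelogram identity for [x - y] and [x - z], in the form used to
    compare two points with their midpoint. *)
Lemma parallelogram x y z :
  `|y - z| ^+ 2 = 2 * `|x - y| ^+ 2 + 2 * `|x - z| ^+ 2
                  - 4 * `|x - 2^-1 *: (y + z)| ^+ 2.
Proof.
rewrite !norm_dotB -!dot_norm !dotE (dotC z y).
by field; rewrite ?pnatr_eq0.
Qed.

(** The inequality that makes a minimizing sequence Cauchy, once [a], [b], [d]
    are the squared distances of the parallelogram identity, [d] being that of
    the midpoint, and [i] is their infimum. *)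
Lemma midpoint_gap (r s i a b d q : R) : r < q / 4 -> s < q / 4 ->
  a < i + r -> b < i + s -> i <= d -> 2 * b + 2 * a - 4 * d < q.
Proof. lra. Qed.

(** A minimizing sequence for the distance to [x] is Cauchy by the
    parallelogram identity, because the midpoint of two of its terms is in [N]
    and cannot be closer to [x] than the infimum.  Its limit [p] minimizes the
    distance, so that perturbing it along any [z] in [N] yields orthogonality. *)
Lemma orthogonal_projection_exists N x : closed_subspace N ->
  exists p, N p /\ forall y, N y -> dot (x - p) y = 0.
Proof.
move=> [sN cN].
pose E := [set `|x - y| ^+ 2 | y in N].
have lbE : lbound E 0 by move=> _ [y _ <-]; exact: sqr_ge0.
have infE : has_inf E.
  by split; [exists (`|x - 0| ^+ 2), 0 => //; exact: subspace0 | exists 0].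
have infP y : N y -> inf E <= `|x - y| ^+ 2.
  by move=> Ny; apply: ge_inf; [case: infE | exists y].
have /choice[y yP] n : exists y, N y /\ `|x - y| ^+ 2 < inf E + n.+1%:R^-1.
  have [|_ [y Ny <-] ylt] := @inf_adherent R E n.+1%:R^-1 _ infE.
    by rewrite invr_gt0 ltr0n.
  by exists y.
have : cvgn y.
  apply/cauchy_cvgP/cauchy_exP => e e0.
  have e4 : 0 < e ^+ 2 / 4 by rewrite divr_gt0 ?exprn_gt0.
  near \oo => m; exists (y m); rewrite /fmap /=; near=> n.
  rewrite -ball_normE /= -(@ltr_pXn2r _ 2) ?nnegrE ?(ltW e0)//.
  rewrite (parallelogram x).
  have := infP _ (subspaceZ 2^-1 sN (subspaceD sN (yP m).1 (yP n).1)).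
  have := (yP m).2; have := (yP n).2.
  have : m.+1%:R^-1 < e ^+ 2 / 4.
    by near: m; exact: (near_infty_natSinv_lt (PosNum e4)).
  have : n.+1%:R^-1 < e ^+ 2 / 4.
    by near: n; exact: (near_infty_natSinv_lt (PosNum e4)).
  exact: midpoint_gap.
move=> /cvg_ex[p yp]; exists p.
have Np : N p.
  by apply: (closed_cvg _ cN _ _ yp); apply: nearW => n; exact: (yP n).1.
split=> // z Nz.
have pmin : `|x - p| ^+ 2 <= inf E.
  rewrite -[leRHS]addr0.
  apply: (ler_cvg_to (a := \oo) (f := fun n => `|x - y n| ^+ 2)
            (g := fun n => inf E + n.+1%:R^-1)).
  - have dp : `|x - y n| @[n --> \oo] --> `|x - p|.
      by apply: cvg_norm; apply: cvgB => //; exact: cvg_cst.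
    exact: (cvgM dp dp).
  - by apply: cvgD; [exact: cvg_cst | exact: cvg_harmonic].
  - by apply: nearW => n; exact/ltW/(yP n).2.
set c := dot (x - p) z.
(* The best step along z is c / |z|^2; the added 1 avoids dividing by 0, and
   the step c / s still decreases the distance unless c = 0. *)
set s := `|z| ^+ 2 + 1.
have s0 : 0 < s by rewrite ltr_wpDl ?sqr_ge0.
have := le_trans pmin (infP _ (subspaceD sN Np (subspaceZ (c / s) sN Nz))).
rewrite opprD addrA (norm_dotB (x - p)) dotZr -/c normrZ exprMn.
rewrite real_normK ?num_real//.
have -> : `|z| ^+ 2 = s - 1 by rewrite addrK.
rewrite -subr_ge0.
have -> : `|x - p| ^+ 2 - 2 * (c / s * c) + (c / s) ^+ 2 * (s - 1) - `|x - p| ^+ 2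
   = - ((c / s) ^+ 2 * (s + 1)).
  by field; rewrite gt_eqF.
rewrite oppr_ge0 (pmulr_lle0 _ (addr_gt0 s0 ltr01)) => h.
have : c / s == 0 by rewrite -sqrf_eq0 eq_le h sqr_ge0.
by rewrite mulf_eq0 invr_eq0 (gt_eqF s0) orbF => /eqP.
Unshelve. all: by end_near. Qed.

(** [orthproj] tests orthogonality against differences from the projected
    point; on a linear subspace these differences exhaust the subspace. *)
Lemma orthprojP N x : closed_subspace N ->
  N (orthproj dot N x) /\ forall y, N y -> dot (x - orthproj dot N x) y = 0.
Proof.
move=> cN; have [sN _] := cN.
have [p [Np pP]] := orthogonal_projection_exists x cN.
have : is_orthogonal_projection dot N x (orthproj dot N x).
  by apply: getPex; exists p; split=> // y Ny; rewrite dotBr !pP// subrr.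
case=> NP PP; split=> // y Ny.
by rewrite -[y](addrK (orthproj dot N x)); apply: PP; exact: subspaceD.
Qed.

Lemma orth_span (A : set X) v w :
  linear_span A v -> (forall u, A u -> dot u w = 0) -> dot v w = 0.
Proof.
move=> [n [c [u [Au ->]]]] Aw; rewrite dotC linear_sum /=.
by rewrite big1// => i _; rewrite dotZr dotC Aw// mulr0.
Qed.

Lemma closed_subspace_orth u : closed_subspace [set y | dot u y = 0].
Proof.
split; first split.
- by apply/mem_set; rewrite /= dot0r.
- move=> c v w /set_mem/= uv /set_mem/= uw.
  by apply/mem_set; rewrite /= dotDr dotZr uv uw mulr0 addr0.
- rewrite -[X in closed X]/(dot u @^-1` [set 0]).
  by apply: preimage_closed; [move=> y _; exact: dot_continuous | exact: closed_eq].
Qed.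

(** Boundedness gives closedness: a functional [w] near [c] differs from [c] on
    the sequence by at most [B * |w - c|], uniformly in the index. *)
Lemma closed_subspace_weak_null (y : nat -> X) (B : R) :
  (forall n, `|y n| <= B) ->
  closed_subspace [set w | dot w (y n) @[n --> \oo] --> 0].
Proof.
move=> yB; split; first split.
- by apply/mem_set => /=; under eq_fun do rewrite dot0l; exact: cvg_cst.
- move=> c v w /set_mem/= yv /set_mem/= yw; apply/mem_set => /=.
  under eq_fun do rewrite dotDl dotZl.
  suff: c * dot v (y n) + dot w (y n) @[n --> \oo] --> c * 0 + 0.
    by rewrite mulr0 addr0.
  by apply: cvgD => //; apply: cvgM => //; exact: cvg_cst.
- move=> w cw; apply/cvgr0Pnorm_lt => e e0.
  have B0 : 0 < B + 1 by rewrite ltr_wpDl// (le_trans _ (yB 0%N)).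
  have d0 : 0 < e / 2 / (B + 1) by rewrite !divr_gt0.
  have [c [/= yc]] := cw _ (nbhsx_ballx w _ d0).
  rewrite -ball_normE /= => wc.
  have e2 : 0 < e / 2 by rewrite divr_gt0.
  near=> n.
  have ycn : `|dot c (y n)| < e / 2 by near: n; exact: cvgr0_norm_lt.
  rewrite -[w](subrK c) dotDl (le_lt_trans (ler_normD _ _))//.
  rewrite [e]splitr ler_ltD//.
  rewrite (le_trans (cauchy_schwarz _ _))//.
  rewrite -[leRHS](divfK (lt0r_neq0 B0)).
  by rewrite ler_pM// ?(ltW wc)// (le_trans (yB n))// lerDl.
Unshelve. all: by end_near. Qed.

(** A vector orthogonal to the weakly-null subspace is orthogonal to each
    complement of [M t], hence lies in every [M t], hence in their intersection;
    the latter being inside the weakly-null subspace, the vector is zero.  This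
    is the density of the sum of the complements of the [M t] in the complement
    of their intersection, phrased without sums of subspaces. *)
Lemma weak_null_of_complements (T : Type) (D : set T) (M : T -> set X)
    (y : nat -> X) (B : R) :
  (forall n, `|y n| <= B) ->
  (forall t, D t -> closed_subspace (M t)) ->
  (forall t w, D t -> (forall v, M t v -> dot w v = 0) ->
    dot w (y n) @[n --> \oo] --> 0) ->
  (forall w, (\bigcap_(t in D) M t) w -> dot w (y n) @[n --> \oo] --> 0) ->
  forall w, dot w (y n) @[n --> \oo] --> 0.
Proof.
move=> yB cM perpM capM w.
have cC := closed_subspace_weak_null yB.
have [p [Cp pP]] := orthogonal_projection_exists w cC.
suff v0 : w - p = 0 by rewrite -[w](subrK p) v0 add0r.
apply/dot_eq0/pP/capM => t Dt.
have [q [Mq qP]] := orthogonal_projection_exists (w - p) (cM t Dt).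
suff -> : w - p = q by [].
apply/subr0_eq/dot_eq0.
by rewrite dotBr (qP q Mq) subr0 dotC; apply/pP/(perpM t).
Qed.

(** * The hyperplane attached to one iterate *)

Section HyperplaneStep.
Variables (N1 N2 : set X) (x x' x'' : X).
Hypotheses (N1s : closed_subspace N1) (N2s : closed_subspace N2) (N1x : N1 x).
Hypotheses (x'E : x' = orthproj dot N2 x) (x''E : x'' = orthproj dot N1 x').

Let N2x' : N2 x'. Proof. by rewrite x'E; case: (orthprojP x N2s). Qed.
Let x'P y : N2 y -> dot (x - x') y = 0.
Proof. by rewrite x'E; case: (orthprojP x N2s) => _; exact. Qed.
Let N1x'' : N1 x''. Proof. by rewrite x''E; case: (orthprojP x' N1s). Qed.
Let x''P y : N1 y -> dot (x' - x'') y = 0.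
Proof. by rewrite x''E; case: (orthprojP x' N1s) => _; exact. Qed.
(* The first summand is orthogonal to N2, the second to N1. *)
Let aE : x - x'' = (x - x') + (x' - x''). Proof. by rewrite addrA subrK. Qed.

Lemma hyperplane_normal_mem : N1 (x - x'').
Proof. by case: N1s => sN1 _; exact: subspaceB. Qed.

Lemma hyperplane_normal_base : dot (x - x'') x = `|x - x'| ^+ 2.
Proof.
by rewrite aE dotDl x''P// addr0 -dot_norm [in RHS]dotBr (x'P N2x') subr0.
Qed.

Lemma hyperplane_normal_orth y : N1 y -> N2 y -> dot (x - x'') y = 0.
Proof. by move=> N1y N2y; rewrite aE dotDl x'P// x''P// addr0. Qed.

(** As [x] is in [N1], the normal is the projection of [x - x'] onto [N1]. *)
Lemma hyperplane_normal_le : `|x - x''| <= `|x - x'|.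
Proof.
have [->|a0] := eqVneq (x - x'') 0; first by rewrite normr0.
rewrite -(@ler_pM2r _ `|x - x''|) ?normr_gt0// -expr2 -dot_norm.
rewrite {1}aE dotDl (x''P hyperplane_normal_mem) addr0.
exact: le_trans (ler_norm _) (cauchy_schwarz _ _).
Qed.

(** The offset of the hyperplane is [<a, x> - |x - x'|^2 = 0] for [a != 0]. *)
Lemma hyperplaneE : hyperplane dot x x' x'' = [set y | dot (x - x'') y = 0].
Proof.
rewrite /hyperplane; case: ifPn => [/eqP ->|a0].
  by apply/seteqP; split=> y //= _; rewrite dot0l.
suff -> : dot (x - x'')
   (x + (`|x - x'| ^+ 2 / `|x - x''| ^+ 2) *: (x'' - x)) = 0 by [].
rewrite dotDr hyperplane_normal_base dotZr -(opprB x x'') dotNr dot_norm.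
by rewrite mulrN divfK ?subrr// sqrf_eq0 normr_eq0.
Qed.

(** For [y] in the hyperplane,
    [|x - x'|^2 = <a, x> = <a, x - y> <= |a| |x - y| <= |x - x'| |x - y|]. *)
Lemma hyperplane_dist y : hyperplane dot x x' x'' y -> `|x - x'| <= `|x - y|.
Proof.
rewrite hyperplaneE /= => ay.
have [->|e0] := eqVneq (x - x') 0; first by rewrite normr0.
rewrite -(@ler_pM2l _ `|x - x'|) ?normr_gt0// -expr2.
rewrite -hyperplane_normal_base -[dot _ x]subr0 -ay -dotBr.
apply: le_trans (ler_norm _) _; apply: le_trans (cauchy_schwarz _ _) _.
by rewrite ler_wpM2r// hyperplane_normal_le.
Qed.

End HyperplaneStep.

End InnerProduct.

(** * The iterates of the algorithm *)

Section AcceleratedProjections.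
Variables (R : realType) (X : completeNormedModType R).
Variables (dot : {dot X for idfun}) (dot_norm : norm_from_dot dot).
Variables (k : nat) (M : nat -> set X).
Hypothesis M_subspace :
  forall m : nat, (1 <= m <= k)%N -> closed_subspace (M m).
Variables (x0 : X) (x x' x'' a : nat -> X) (l : nat -> nat).
Variables (J : nat -> set nat) (Ht : nat -> set X).
Hypothesis x0_M1 : M 1%N x0.
Hypothesis alg : accelerated_projections2 dot k M x0 x x' x'' a l J Ht.

Let D := [set m | (1 <= m <= k)%N].
Let Mcap := \bigcap_(m in D) M m.

Let k_ge1 : (1 <= 1 <= k)%N.
Proof.
have [/andP[l2 lk] _] := alg.2 0%N.
by rewrite /= (leq_trans _ lk)// (leq_trans _ l2).
Qed.
Let M1_subspace : closed_subspace (M 1%N) := M_subspace k_ge1.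
Let l_bounds i : (1 <= l i <= k)%N.
Proof.
by have [/andP[l2 lk] _] := alg.2 i; rewrite lk andbT (leq_trans _ l2).
Qed.
Let Ml_subspace i : closed_subspace (M (l i)) := M_subspace (l_bounds i).

Let x'E i : x' i = orthproj dot (M (l i)) (x i).
Proof. by have [_ []] := alg.2 i. Qed.
Let x''E i : x'' i = orthproj dot (M 1%N) (x' i).
Proof. by have [_ [_ []]] := alg.2 i. Qed.
Let aE i : a i = x i - x'' i.
Proof. by have [_ [_ [_ []]]] := alg.2 i. Qed.
Let J_le i j : J i j -> (j <= i)%N.
Proof. by have [_ [_ [_ [_ [Ji _]]]]] := alg.2 i => /Ji. Qed.
Let J_self i : J i i.
Proof. by have [_ [_ [_ [_ [_ []]]]]] := alg.2 i. Qed.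
Let HtE i : Ht i = hyperplane_bigcap dot x x' x'' (J i).
Proof. by have [_ [_ [_ [_ [_ [_ []]]]]]] := alg.2 i. Qed.
Let xS i : x i.+1 = orthproj dot (Ht i) (x i).
Proof. by have [_ [_ [_ [_ [_ [_ [_]]]]]]] := alg.2 i. Qed.

Let Ht_of_M1 i : (forall j, (j <= i)%N -> M 1%N (x j)) ->
  Ht i = \bigcap_(j in J i) [set y | dot (a j) y = 0].
Proof.
move=> M1x; rewrite HtE; apply: eq_bigcapr => j /J_le /M1x M1xj.
by rewrite aE; exact: (hyperplaneE dot_norm M1_subspace (Ml_subspace j)).
Qed.

Let Ht_subspace_of_M1 i : (forall j, (j <= i)%N -> M 1%N (x j)) ->
  closed_subspace (Ht i).
Proof.
move=> M1x; rewrite Ht_of_M1//; apply: closed_subspace_bigcap => j _.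
exact: (closed_subspace_orth dot_norm).
Qed.

(** The normals lie in [M_1], so projecting [x_{i+1}] onto [M_1] does not leave
    [Ht_i]; as [x_i] is in [M_1], the projected point [p] would be closer to
    [x_i] than [x_{i+1}], unless both are equal. *)
Lemma iterate_in_M1 i : M 1%N (x i).
Proof.
elim/ltn_ind: i => -[|i] IH; first by rewrite alg.1.
have M1x j : (j <= i)%N -> M 1%N (x j) by move=> ji; apply: IH.
have [Htx xP] := orthprojP dot_norm (x i) (Ht_subspace_of_M1 M1x).
rewrite -xS in Htx xP.
have [p [M1p pP]] := orthogonal_projection_exists dot_norm (x i.+1) M1_subspace.
have Htp : Ht i p.
  move: Htx; rewrite Ht_of_M1// => Htx j Jj /=.
  have := pP (a j); rewrite dotC dotBr (Htx j Jj) sub0r => ap.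
  apply/eqP; rewrite -oppr_eq0; apply/eqP/ap; rewrite aE.
  apply: (@hyperplane_normal_mem _ _ dot dot_norm (M 1%N) (x j) (x' j)) => //.
  exact/M1x/J_le.
suff -> : x i.+1 = p by [].
(* x_{i+1} - p is orthogonal to x_i and p, which lie in M_1, and to
   x_i - x_{i+1}, as x_{i+1} and p lie in Ht_i. *)
apply/subr0_eq/(dot_eq0 dot_norm).
rewrite dotBr (pP p M1p) subr0.
have := xP _ Htx; rewrite dotBl.
have := xP _ Htp; rewrite dotBl.
have := pP _ (M1x i (leqnn i)); rewrite dotBl.
rewrite dotBl (dotC _ p (x i.+1)) (dotC _ p (x i)) (dotC _ (x i.+1) (x i)).
lra.
Qed.

Let M1x i : forall j, (j <= i)%N -> M 1%N (x j).
Proof. by move=> j _; exact: iterate_in_M1. Qed.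

Lemma Ht_orthP i y : Ht i y <-> forall j, J i j -> dot (a j) y = 0.
Proof. by rewrite (Ht_of_M1 (@M1x i)). Qed.

Lemma next_iterate_in_Ht i : Ht i (x i.+1).
Proof.
by rewrite xS; have [] := orthprojP dot_norm (x i) (Ht_subspace_of_M1 (@M1x i)).
Qed.

Lemma step_orth i y : Ht i y -> dot (x i - x i.+1) y = 0.
Proof.
rewrite xS; have [_] := orthprojP dot_norm (x i) (Ht_subspace_of_M1 (@M1x i)).
exact.
Qed.

Lemma Mcap_sub_Ht i w : Mcap w -> Ht i w.
Proof.
move=> Nw; apply/Ht_orthP => j _; rewrite aE.
apply: (@hyperplane_normal_orth _ _ dot dot_norm (M 1%N) (M (l j))) => //.
- by apply: Nw; exact: k_ge1.
- by apply: Nw; exact: l_bounds.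
Qed.

Lemma residual_le_step i : `|x i - x' i| <= `|x i - x i.+1|.
Proof.
apply: (@hyperplane_dist _ _ dot dot_norm (M 1%N) (M (l i)) _ _ (x'' i)) => //.
  exact: iterate_in_M1.
by have := next_iterate_in_Ht i; rewrite HtE => /(_ i); apply.
Qed.

(** Since [Ht_i] is linear, [x_{i+1}] itself is orthogonal to the step. *)
Lemma pythagoras_step i :
  `|x i| ^+ 2 = `|x i.+1| ^+ 2 + `|x i - x i.+1| ^+ 2.
Proof.
have := step_orth (next_iterate_in_Ht i); rewrite dotBl (norm_dotB dot_norm) dot_norm; lra.
Qed.

Lemma norm_iterate_le i : `|x i| <= `|x0|.
Proof.
elim: i => [|i IH]; first by rewrite alg.1.
apply: le_trans IH; rewrite -(@ler_pXn2r _ 2) ?nnegrE//.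
by rewrite (pythagoras_step i) lerDl sqr_ge0.
Qed.

Lemma step_cvg0 : `|x i - x i.+1| @[i --> \oo] --> 0.
Proof.
pose u i := `|x i| ^+ 2.
have : cvgn u.
  apply: nonincreasing_is_cvgn.
    apply/nonincreasing_seqP => i; rewrite /u (pythagoras_step i) lerDl.
    exact: sqr_ge0.
  by exists 0 => _ [i _ <-]; exact: sqr_ge0.
move=> /cvg_ex[c uc].
have usc : u i.+1 @[i --> \oo] --> c by rewrite (cvg_shiftS u).
have d2 : u i - u i.+1 @[i --> \oo] --> 0.
  by rewrite -(subrr c); exact: cvgB.
apply/cvgr0Pnorm_lt => e e0; near=> i.
rewrite normr_id -(@ltr_pXn2r _ 2) ?nnegrE ?(ltW e0)//.
have -> : `|x i - x i.+1| ^+ 2 = u i - u i.+1.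
  by rewrite /u (pythagoras_step i) addrAC subrr add0r.
apply: le_lt_trans (ler_norm _) _; near: i; apply: cvgr0_norm_lt => //.
by rewrite exprn_gt0.
Unshelve. all: by end_near. Qed.

Hypothesis condB : forall i : nat, linear_span (a @` J i) (x0 - x i).

(** Condition (B): [x_0 - x_i] is spanned by normals of [Ht_i], so [x_{i+1}] is
    also the projection of [x_0] onto [Ht_i]. *)
Lemma start_step_orth i y : Ht i y -> dot (x0 - x i.+1) y = 0.
Proof.
move=> Hy; rewrite -(subrKA (x i)) dotDl (step_orth Hy) addr0.
by apply: (orth_span (condB i)) => _ [j Jj <-]; exact: (Ht_orthP i y).1.
Qed.

Lemma start_orth_self i : dot (x0 - x i) (x i) = 0.
Proof.
case: i => [|i]; first by rewrite alg.1 subrr dot0l.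
exact/start_step_orth/next_iterate_in_Ht.
Qed.

Lemma start_orth_Mcap i w : Mcap w -> dot (x0 - x i) w = 0.
Proof.
move=> Nw; case: i => [|i]; first by rewrite alg.1 subrr dot0l.
exact/start_step_orth/Mcap_sub_Ht.
Qed.

Hypothesis condA : exists pbar : nat, forall m i : nat,
  (2 <= m <= k)%N -> (0 < i)%N ->
  exists p : nat, (p <= pbar)%N /\
    x' (i + p)%N = orthproj dot (M m) (x (i + p)%N).

(** The functional [w] only sees the component of [x_i] off [M_m], so [x_i - z]
    may be replaced by [x_i - x'_{i+p}] for the next index [i + p] at which
    [M_m] is visited.  Its norm is at most the length of the path from [x_i] to
    [x_{i+p}] plus the residual there, hence at most a sum of boundedly many
    steps; for [m = 1] the iterates are in [M_m]. *)
Lemma weak_null_perp m w z : D m -> Mcap z -> (forall v, M m v -> dot w v = 0) ->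
  dot w (x i - z) @[i --> \oo] --> 0.
Proof.
move=> Dm Nz wM; have Mz : M m z by exact: Nz.
have [m1|m1] := eqVneq m 1%N.
  under eq_fun => i.
    rewrite wM; last first.
      by case: (M_subspace Dm) => sM _; apply: subspaceB => //; rewrite m1;
         exact: iterate_in_M1.
    over.
  exact: cvg_cst.
have m2 : (2 <= m <= k)%N.
  by move: Dm => /andP[m0 ->]; rewrite andbT ltn_neqAle eq_sym m1.
have [q qP] := condA.
(* One step more than the window, to dominate the residual at its end. *)
pose s n := \sum_(j < q.+1) `|x (n + j)%N - x (n + j).+1|.
apply: (@cvg0_dominated _ _ (fun n => `|w| * s n)); last first.
  rewrite -(mulr0 `|w|); apply: cvgM; first exact: cvg_cst.
  exact: (window_sum_cvg0 q.+1 step_cvg0).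
near=> n.
have n0 : (0 < n)%N by near: n; exists 1%N.
have [p [pq x'p]] := qP m n m2 n0.
have Mx' : M m (x' (n + p)%N).
  by rewrite x'p; case: (orthprojP dot_norm (x (n + p)%N) (M_subspace Dm)).
have -> : dot w (x n - z) = dot w (x n - x' (n + p)%N).
  by rewrite !dotBr (wM _ Mz) (wM _ Mx').
apply: le_trans (cauchy_schwarz dot_norm _ _) _; apply: ler_wpM2l => //.
apply: (@le_trans _ _ (\sum_(j < p.+1) `|x (n + j)%N - x (n + j).+1|)).
  rewrite big_ord_recr /= (le_trans (ler_distD (x (n + p)%N) _ _))//.
  by apply: lerD; [exact: dist_le_steps | exact: residual_le_step].
rewrite /s -!(big_mkord xpredT (fun j => `|x (n + j)%N - x (n + j).+1|)).
rewrite [leRHS](big_cat_nat (n := p.+1))//= lerDl.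
exact: sumr_ge0.
Unshelve. all: by end_near. Qed.

Lemma iterates_cvg : x @ \oo --> orthproj dot Mcap x0.
Proof.
set z := orthproj dot Mcap x0.
have [Nz zP] : Mcap z /\ forall y, Mcap y -> dot (x0 - z) y = 0.
  exact/(orthprojP dot_norm)/closed_subspace_bigcap.
have weak w : dot w (x i - z) @[i --> \oo] --> 0.
  move: w; apply: (weak_null_of_complements dot_norm (D := D) (M := M)
    (B := `|x0| + `|z|)).
  - by move=> i; rewrite (le_trans (ler_normB _ _))// lerD2r norm_iterate_le.
  - exact: M_subspace.
  - by move=> m w Dm; exact: weak_null_perp.
  - move=> w Nw; under eq_fun => i.
      rewrite -(subrKA x0) dotDr -opprB dotNr dotC start_orth_Mcap// oppr0 add0r.
      rewrite dotC zP//.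
      over.
    exact: cvg_cst.
have norm_sqr i : `|x i - z| ^+ 2 = dot (x0 - z) (x i - z).
  have orth : dot (x0 - x i) (x i - z) = 0.
    by rewrite dotBr start_orth_self start_orth_Mcap// subrr.
  by rewrite -dot_norm -[x0 - z](subrKA (x i)) [in RHS]dotDl orth add0r.
apply/cvgrPdist_lt => e e0; near=> i.
rewrite distrC -(@ltr_pXn2r _ 2) ?nnegrE ?(ltW e0)// norm_sqr.
apply: le_lt_trans (ler_norm _) _; near: i; apply: cvgr0_norm_lt => //.
by rewrite exprn_gt0.
Unshelve. all: by end_near. Qed.

End AcceleratedProjections.

Theorem theorem3p13 (R : realType) (X : completeNormedModType R)
    (dot : {dot X for idfun}) (dot_norm : norm_from_dot dot)
    (k : nat) (M : nat -> set X)
    (M_subspace : forall m : nat, (1 <= m <= k)%N -> closed_subspace (M m))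
    (x0 : X) (x0_M1 : M 1%N x0)
    (x x' x'' a : nat -> X) (l : nat -> nat) (J : nat -> set nat)
    (Ht : nat -> set X)
    (alg : accelerated_projections2 dot k M x0 x x' x'' a l J Ht)
    (condA : exists pbar : nat, forall m i : nat, (2 <= m <= k)%N -> (0 < i)%N ->
       exists p : nat, (p <= pbar)%N /\
         x' (i + p)%N = orthproj dot (M m) (x (i + p)%N))
    (condB : forall i : nat, linear_span (a @` J i) (x0 - x i)) :
  x @ \oo --> orthproj dot (\bigcap_(m in [set m | (1 <= m <= k)%N]) M m) x0.
Proof. exact: (iterates_cvg dot_norm M_subspace x0_M1 alg condB condA). Qed.
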